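(* Let $L$ be a normed linear space over $\mathbb{F}$. Then $L$ can be isometrically embedded into $C(Y)$ for a compact Hausdorff space $Y$, namely, for \[Y=\beta\big(L^*\setminus\{0\}\big),\] the Stone--Čech compactification of $L^*\setminus\{0\}$, where $L^*\setminus\{0\}$ is endowed with the supremum norm topology. That is, there exists a mapping $\Theta:L\to C\big(\beta(L^*\setminus\{0\})\big)$ which preserves addition, scalar multiplication and norm.
   Context: The field of scalars $\mathbb{F}$ is fixed throughout and is either $\mathbb{R}$ or $\mathbb{C}$. For a normed linear space $L$ over $\mathbb{F}$, $L^*$ denotes the set of all continuous $\mathbb{F}$-valued linear mappings on $L$; the supremum norm on $L^*$ is the usual dual norm $\|x^*\|=\sup\{|x^*(x)|:x\in L,\ \|x\|\leq 1\}$, and $L^*\setminus\{0\}$ carries the (subspace) topology induced by this norm. For a compact Hausdorff space $X$, $C(X)$ denotes the set of all continuous $\mathbb{F}$-valued mappings on $X$, which is a normed linear space over $\mathbb{F}$ with the supremum norm and pointwise addition and scalar multiplication. A compactification of a completely regular space $X$ is a compact Hausdorff space which contains $X$ as a dense subspace. The Stone--Čech compactification $\beta X$ of a completely regular space $X$ is the unique compactification of $X$ such that every continuous bounded mapping $f:X\to\mathbb{F}$ extends to a continuous mapping $F:\beta X\to\mathbb{F}$. An isometric embedding of $L$ into $C(Y)$ is a mapping $L\to C(Y)$ preserving addition, scalar multiplication and norm. *)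

(* Defs.v *)
From HB Require Import structures.
From mathcomp Require Import all_boot all_order all_algebra.
From mathcomp Require Import complex.
From mathcomp Require Import all_classical all_reals all_analysis.

Set Implicit Arguments.
Unset Strict Implicit.
Unset Printing Implicit Defensive.

Import Order.TTheory GRing.Theory Num.Theory.
Import numFieldNormedType.Exports.

Local Open Scope classical_set_scope.
Local Open Scope ring_scope.

Variant scalar_kind := RealScalars | ComplexScalars.

Definition scalar_field (R : realType) (k : scalar_kind) : numFieldType :=
  match k with RealScalars => R | ComplexScalars => R[i] end.

(* The norm of a normedModType over K is K-valued.  For K = R[i] the order is
   the partial order x <= y <-> 0 <= y - x (a nonnegative real), so that a
   nonempty set of nonnegative reals has the same supremum in R and in R[i].
   The default value 0 is the supremum over an empty set of indices. *)
Definition supnorm (K : numFieldType) (T : Type) (A : set T) (f : T -> K) : K :=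
  supremum 0 [set `|f t| | t in A].

Section supnorm_theory.
Variables (R : realType) (k : scalar_kind).
Local Notation F := (scalar_field R k).

Lemma scalar_supremums (A : set F) : A !=set0 -> (forall x, A x -> 0 <= x) ->
  has_ubound A -> supremums A !=set0.
Proof.
case: k A => /= A [a Aa] A0 [M AM].
  have supA : has_sup A by split; [exists a | exists M].
  exists (sup A); split; first exact: (ub_le_sup supA.2).
  by move=> y; apply: ge_sup; exists a.
have ReA x : A x -> x = (complex.Re x)%:C%C.
  by move=> Ax; rewrite RRe_real// ger0_real// A0.
pose B := [set complex.Re x | x in A].
have subAB x : A x -> B (complex.Re x) by move=> Ax; exists x.
have ubB y : ubound A y -> ubound B (complex.Re y).
  by move=> Ay _ [x Ax <-]; have := Ay _ Ax; rewrite lecE => /andP[].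
have supB : has_sup B.
  by split; [exists (complex.Re a), a | exists (complex.Re M); exact: ubB].
exists (sup B)%:C%C; split.
  move=> x Ax; rewrite (ReA x Ax) lecR.
  by apply: (ub_le_sup supB.2); exact: subAB.
move=> y Ay; have := Ay _ Aa; rewrite (ReA a Aa) !lecE /= => /andP[-> _] /=.
apply: ge_sup; first exact: supB.1.
exact: ubB.
Qed.

Variables (T : Type) (A : set T).
Implicit Types f g : T -> F.

Lemma supnorm_ub f M : (forall t, A t -> `|f t| <= M) ->
  forall t, A t -> `|f t| <= supnorm A f.
Proof.
move=> fM t At; rewrite /supnorm /supremum.
set S := [set _ | _ in _].
have St : S `|f t| by exists t.
have [S0|_] := eqVneq S set0; first by move: St; rewrite S0.
have [|_ [t' _ <-]||s sS] := @scalar_supremums S => //; first by exists `|f t|.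
  by exists M => _ [t' At' <-]; exact: fM.
by case: xgetP => [_ -> [+ _]|/(_ s)//]; apply.
Qed.

Lemma supnorm_le f M : 0 <= M -> (forall t, A t -> `|f t| <= M) ->
  supnorm A f <= M.
Proof.
move=> M0 fM; rewrite /supnorm /supremum; set S := [set _ | _ in _].
have [//|S0] := eqVneq S set0.
have SM : ubound S M by move=> _ [t' At' <-]; exact: fM.
by case: xgetP => [_ -> [_ +]|//]; apply.
Qed.

Lemma supnorm_ge0 f : 0 <= supnorm A f.
Proof.
rewrite /supnorm /supremum; set S := [set _ | _ in _].
have [//|/set0P[_ [t At _]]] := eqVneq S set0.
case: xgetP => [_ -> [ub _]|//].
by apply: (le_trans (normr_ge0 (f t))); apply: ub; exists t.
Qed.

Lemma supnormD f g M N : (forall t, A t -> `|f t| <= M) ->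
  (forall t, A t -> `|g t| <= N) ->
  supnorm A (f + g) <= supnorm A f + supnorm A g.
Proof.
move=> fM gN; apply: supnorm_le => [|t At];
    first by rewrite addr_ge0 ?supnorm_ge0.
by rewrite (le_trans (ler_normD _ _))// lerD//;
  [exact: supnorm_ub fM _ At|exact: supnorm_ub gN _ At].
Qed.

Lemma supnormZ (a : F) f M : (forall t, A t -> `|f t| <= M) ->
  supnorm A (a *: f) = `|a| * supnorm A f.
Proof.
move=> fM; have leZ (b : F) g N : (forall t, A t -> `|g t| <= N) ->
    supnorm A (b *: g) <= `|b| * supnorm A g.
  move=> gN; apply: supnorm_le => [|t At];
    first by rewrite mulr_ge0 ?supnorm_ge0.
  by rewrite normrM ler_wpM2l//; exact: supnorm_ub gN _ At.
apply/eqP; rewrite eq_le (leZ _ _ _ fM)/=.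
have [->|a0] := eqVneq a 0; first by rewrite normr0 mul0r supnorm_ge0.
have aM t : A t -> `|(a *: f) t| <= `|a| * M.
  by move=> At; rewrite normrM ler_wpM2l// fM.
rewrite -ler_pdivlMl ?normr_gt0// -normfV.
by rewrite -[in leLHS](scalerK a0 f); exact: leZ aM.
Qed.

Lemma supnorm_eq0 f M : (forall t, A t -> `|f t| <= M) ->
  supnorm A f = 0 -> forall t, A t -> f t = 0.
Proof.
move=> fM f0 t At; apply/eqP; rewrite -normr_le0 -f0.
exact: supnorm_ub fM _ At.
Qed.

End supnorm_theory.

Section dual.
Variables (K : numFieldType) (L : normedModType K).

Definition dual_pred : {pred L -> K} :=
  mem [set f : L -> K | linear f /\ continuous f].

Record dual := Dual { dual_fun :> L -> K; _ : dual_fun \in dual_pred }.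

HB.instance Definition _ := [isSub for dual_fun].
HB.instance Definition _ := [Choice of dual by <:].

Lemma dual_linear (f : dual) : linear f.
Proof. by have := valP f; rewrite inE => -[]. Qed.

Lemma dual_continuous (f : dual) : continuous f.
Proof. by have := valP f; rewrite inE => -[]. Qed.

Lemma dual_submod_closed : submod_closed dual_pred.
Proof.
split=> [|a f g].
  rewrite inE; split=> [b x y|]; first by rewrite /= scaler0 addr0.
  exact: cst_continuous.
rewrite !inE => -[lf cf] [lg cg]; split=> [b x y|x].
  rewrite -![(_ + _) _]/(_ + _) -![(_ *: _) _]/(_ *: _) lf lg.
  by rewrite !scalerDr !scalerA (mulrC a b) addrACA.
by apply: cvgD; [apply: cvgZr; exact: cf|exact: cg].
Qed.

HB.instance Definition _ :=
  GRing.isSubmodClosed.Build K (L -> K) dual_pred dual_submod_closed.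
HB.instance Definition _ := [SubChoice_isSubLmodule of dual by <:].

End dual.

Section dual_normed.
Variables (R : realType) (k : scalar_kind).
Variables (L : normedModType (scalar_field R k)).
Local Notation F := (scalar_field R k).
Implicit Types f g : dual L.

Let B := [set x : L | `|x| <= 1].

Definition dual_norm f : F := supnorm B f.

Lemma dual_bounded f : exists M : F, forall x, B x -> `|f x| <= M.
Proof.
pose lf := @GRing.isLinear.Build F L F *:%R f (dual_linear f).
pose f' : {linear L -> F} := HB.pack (dual_fun f) lf.
have /linear_boundedP : bounded_near f' (nbhs 0).
  by apply: continuous_linear_bounded; exact: (@dual_continuous _ _ f 0).
case=> r [r0 fr]; exists (`|r| + 1) => x Bx.
have rr : r < `|r| + 1.
  by rewrite (le_lt_trans (real_ler_norm r0))// ltrDl ltr01.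
by rewrite (le_trans (fr _ rr x))// -[leRHS]mulr1 ler_wpM2l// addr_ge0.
Qed.

Let dual_normD f g : dual_norm (f + g) <= dual_norm f + dual_norm g.
Proof.
have [M fM] := dual_bounded f; have [N gN] := dual_bounded g.
exact: supnormD fM gN.
Qed.

Let dual_normZ (a : F) f : dual_norm (a *: f) = `|a| * dual_norm f.
Proof. by have [M fM] := dual_bounded f; exact: supnormZ fM. Qed.

Let dual_norm0_eq0 f : dual_norm f = 0 -> f = 0.
Proof.
have [M fM] := dual_bounded f => /(supnorm_eq0 fM) f0.
apply/val_inj/funext => x /=.
have fZ a y : f (a *: y) = a *: f y.
  have fl : f 0 = 0 by apply: f0; rewrite /B/= normr0 ler01.
  by have := dual_linear f a y 0; rewrite addr0 fl addr0.
have [->|x0] := eqVneq x 0; first by apply: f0; rewrite /B/= normr0 ler01.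
have nx : `|x| != 0 by rewrite normr_eq0.
rewrite -[x](scalerKV nx) fZ f0 ?scaler0//.
by rewrite /B/= normrZ normfV normr_id mulVf.
Qed.

HB.instance Definition _ :=
  Lmodule_isNormed.Build F (dual L) dual_normD dual_normZ dual_norm0_eq0.

End dual_normed.

Section punctured_dual.
Variables (R : realType) (k : scalar_kind).
Variables (L : normedModType (scalar_field R k)).

Definition punctured_dual : topologicalType := [set f : dual L | f != 0].

End punctured_dual.

(* Possibly empty: dual L has no nonzero element when L is trivial. *)
Record compactHausdorffType := CompactHausdorff {
  compactHausdorff_sort :> topologicalType;
  compactHausdorff_compact : compact [set: compactHausdorff_sort];
  compactHausdorff_hausdorff : hausdorff_space compactHausdorff_sort }.

Section cfun.
Variables (K : numFieldType) (Y : compactHausdorffType).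

Definition cfun_pred : {pred Y -> K} := mem [set f : Y -> K | continuous f].

Record cfun := Cfun { cfun_fun :> Y -> K; _ : cfun_fun \in cfun_pred }.

HB.instance Definition _ := [isSub for cfun_fun].
HB.instance Definition _ := [Choice of cfun by <:].

Lemma cfun_continuous (f : cfun) : continuous f.
Proof. by have := valP f; rewrite inE. Qed.

Lemma cfun_submod_closed : submod_closed cfun_pred.
Proof.
split=> [|a f g]; first by rewrite inE; exact: cst_continuous.
rewrite !inE => cf cg x.
by apply: cvgD; [apply: cvgZr; exact: cf|exact: cg].
Qed.

HB.instance Definition _ :=
  GRing.isSubmodClosed.Build K (Y -> K) cfun_pred cfun_submod_closed.
HB.instance Definition _ := [SubChoice_isSubLmodule of cfun by <:].

Lemma cfun_bounded (f : cfun) :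
  exists M : K, forall y, [set: Y] y -> `|f y| <= M.
Proof.
have /compact_near_coveringP cY := compactHausdorff_compact (c := Y).
have [|M [M0 fM]] := cY K +oo (fun M y => `|f y| <= M) _.
  move=> y _; exists ([set z | `|f y - f z| < 1], [set M | `|f y| + 1 < M]).
    split=> /=.
      have /cvgrPdist_lt /(_ 1 ltr01) := @cfun_continuous f y.
      exact.
    by exists (`|f y| + 1); split => //; rewrite rpredD// realE ler01.
  move=> [z M] /= [zy yM]; apply: le_trans (ltW yM).
  have -> : f z = f y - (f y - f z) by rewrite opprB addrC subrK.
  by rewrite (le_trans (ler_normB _ _))// lerD2l ltW.
exists (M + 1) => y _; apply: fM => //.
by rewrite ltrDl ltr01.
Qed.

End cfun.

Section cfun_normed.
Variables (R : realType) (k : scalar_kind) (Y : compactHausdorffType).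
Local Notation F := (scalar_field R k).
Implicit Types f g : cfun F Y.

Definition cfun_norm f : F := supnorm [set: Y] f.

Let cfun_normD f g : cfun_norm (f + g) <= cfun_norm f + cfun_norm g.
Proof.
have [M fM] := cfun_bounded f; have [N gN] := cfun_bounded g.
exact: supnormD fM gN.
Qed.

Let cfun_normZ (a : F) f : cfun_norm (a *: f) = `|a| * cfun_norm f.
Proof. by have [M fM] := cfun_bounded f; exact: supnormZ fM. Qed.

Let cfun_norm0_eq0 f : cfun_norm f = 0 -> f = 0.
Proof.
have [M fM] := cfun_bounded f => /(supnorm_eq0 fM) f0.
by apply/val_inj/funext => y; exact: f0.
Qed.

HB.instance Definition _ :=
  Lmodule_isNormed.Build F (cfun F Y) cfun_normD cfun_normZ cfun_norm0_eq0.

End cfun_normed.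

(* X is identified with its image in Y along i; the first two clauses say that
   i is a homeomorphism onto range i. *)
Definition is_compactification (X : topologicalType) (Y : compactHausdorffType)
    (i : X -> Y) : Prop :=
  [/\ injective i,
      forall U : set X, open U <-> exists2 V : set Y, open V & U = i @^-1` V
    & dense (range i)].

Definition is_stone_cech (K : numFieldType) (X : topologicalType)
    (bX : compactHausdorffType) (i : X -> bX) : Prop :=
  is_compactification i /\
  forall f : X -> K, continuous f -> bounded_fun f ->
    exists2 g : bX -> K, continuous g & forall x, g (i x) = f x.

(* Main.v *)
Require Import Defs.
From HB Require Import structures.
From mathcomp Require Import all_boot all_order all_algebra.
From mathcomp Require Import complex.
From mathcomp Require Import all_classical all_reals all_analysis.
From mathcomp Require Import ring lra.

(**
Write X for the punctured dual.  A point x of L gives the function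
  x^ : f |-> f x / |f|
on X, which is continuous and bounded by |x|; it therefore extends to a
continuous function on any Stone-Cech compactification Y of X.  As X is dense
in Y, the extension is unique, so that it depends linearly on x, and its
supremum over Y is still at most |x|.  That supremum is exactly |x| by the
Hahn-Banach theorem: for x != 0 there is a functional f of norm at most 1 with
|f x| = |x|, so f lies in X and |x^ f| >= |x|.  This is
[stone_cech_embedding].

Hahn-Banach is obtained from Zorn's lemma applied to sublinear functionals
ordered pointwise, rather than to partially defined linear ones.  A minimal
sublinear functional is linear ([minimal_sublinear_linear]), because replacing
p by
  x |-> inf_(t >= 0) (p (x + t y) - t p y)
gives a sublinear functional below p.  The same replacement, applied to the
norm with y = x0 before minimizing, forces the minimal functional to agree with
the norm at x0 ([hahn_banach_sublinear]).  Over the complex numbers, a real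
functional u is completed to u(x) - i u(i x), and rotating a vector by a
unimodular scalar shows that the bound by the norm is preserved.

A Stone-Cech compactification of X exists because X is a subset of a normed
space: the functions y |-> 1 / (1 + |x - y|) separate points from closed sets,
so that evaluation embeds X into the product, over all bounded continuous
functions, of copies of the scalar field.  Each coordinate stays in a compact
set, so by Tychonoff the closure of the image is compact, and a bounded
continuous function extends to it as a coordinate projection
([stone_cechP], [subset_stone_cech_exists]).
*)

Set Implicit Arguments.
Unset Strict Implicit.
Unset Printing Implicit Defensive.

Import Order.TTheory GRing.Theory Num.Theory.
Import numFieldNormedType.Exports.

Local Open Scope classical_set_scope.
Local Open Scope ring_scope.

(** * Sublinear functionals and the Hahn-Banach theorem *)

Section sublinear.
Variables (R : realType) (V : lmodType R).
Implicit Types (p q : V -> R) (x y z : V).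

Definition sublinear p := (forall x y, p (x + y) <= p x + p y) /\
  (forall a x, 0 <= a -> p (a *: x) = a * p x).

Lemma sublinear0 p : sublinear p -> p 0 = 0.
Proof. by move=> [_ pZ]; rewrite -(scale0r 0) pZ// mul0r. Qed.

Lemma sublinear_geN p x : sublinear p -> - p (- x) <= p x.
Proof.
move=> sp; rewrite -subr_ge0 opprK.
by have := sp.1 x (- x); rewrite subrr (sublinear0 sp).
Qed.

(** The inequality for a and for its inverse give the equality. *)
Lemma sublinear_pZ p : (forall a x, 0 < a -> p (a *: x) <= a * p x) ->
  p 0 = 0 -> forall a x, 0 <= a -> p (a *: x) = a * p x.
Proof.
move=> pZ p0 a x; rewrite le_eqVlt => /predU1P[<-|a0].
  by rewrite scale0r mul0r.
apply/eqP; rewrite eq_le pZ//= -ler_pdivlMl//.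
by rewrite -[in leLHS](scalerK (lt0r_neq0 a0) x) pZ// invr_gt0.
Qed.

(** The largest sublinear functional q below p with q (- y) <= - p y, that is,
    the one that makes p linear along y. *)
Definition slide p y x : R :=
  inf [set p (x + t *: y) - t * p y | t in [set t | 0 <= t]].

(** The subadditivity of p, applied to (x + t y) + (- x), bounds the infimum
    from below. *)
Lemma slide_lbound p y x : sublinear p ->
  lbound [set p (x + t *: y) - t * p y | t in [set t | 0 <= t]] (- p (- x)).
Proof.
move=> sp _ [t /= t0 <-]; rewrite lerBrDl -sp.2// lerBlDr.
by rewrite (le_trans _ (sp.1 _ _))// addrAC subrr add0r.
Qed.

Lemma slide_le p y x t : sublinear p -> 0 <= t ->
  slide p y x <= p (x + t *: y) - t * p y.
Proof.
move=> sp t0; apply: ge_inf; last by exists t.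
by exists (- p (- x)); exact: slide_lbound.
Qed.

Lemma le_slide p y x m :
  (forall t, 0 <= t -> m <= p (x + t *: y) - t * p y) -> m <= slide p y x.
Proof.
move=> mp; apply: lb_le_inf.
  by exists (p (x + 0 *: y) - 0 * p y), 0 => /=.
by move=> _ [t /= t0 <-]; exact: mp.
Qed.

Lemma slide_le_id p y x : sublinear p -> slide p y x <= p x.
Proof.
move=> sp; have := @slide_le p y x 0 sp (lexx _).
by rewrite scale0r mul0r addr0 subr0.
Qed.

Lemma slide_sublinear p y : sublinear p -> sublinear (slide p y).
Proof.
move=> sp; split=> [x z|].
  rewrite -lerBlDr; apply: le_slide => s s0.
  rewrite lerBlDl -lerBlDr; apply: le_slide => t t0.
  rewrite lerBlDl (le_trans (slide_le _ _ _ (addr_ge0 s0 t0)))//.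
  have := sp.1 (x + s *: y) (z + t *: y).
  by rewrite addrACA -scalerDl; lra.
apply: sublinear_pZ => [a x a0|].
  rewrite -ler_pdivrMl//; apply: le_slide => t t0; rewrite ler_pdivrMl//.
  rewrite (le_trans (slide_le _ _ _ (mulr_ge0 (ltW a0) t0)))//.
  by rewrite -scalerA -scalerDr sp.2 ?(ltW a0)// -mulrA -mulrBr.
apply/eqP; rewrite eq_le (le_trans (slide_le_id _ _ sp)) ?(sublinear0 sp)//=.
by apply: le_slide => t t0; rewrite add0r sp.2// subrr.
Qed.

(** By minimality [slide p y] is p itself, and the term t = 1 of its infimum
    reads p x <= p (x + y) - p y, the converse of subadditivity. *)
Lemma minimal_sublinear_linear p : sublinear p ->
  (forall q, sublinear q -> (forall x, q x <= p x) -> q = p) -> scalar p.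
Proof.
move=> sp minp.
have pD x y : p (x + y) = p x + p y.
  apply/eqP; rewrite eq_le sp.1/= -lerBrDr.
  rewrite -[in leLHS](minp _ (slide_sublinear y sp)) => [|z];
    last exact: slide_le_id.
  by rewrite -[y in p (x + y)]scale1r -[p y]mul1r slide_le.
have pN x : p (- x) = - p x.
  by apply/eqP; rewrite -addr_eq0 -pD addNr (sublinear0 sp).
move=> a x y; rewrite pD; congr (_ + _).
have [a0|/ltW a0] := leP 0 a; first exact: sp.2.
by rewrite -[a]opprK scaleNr pN sp.2 ?oppr_ge0 ?opprK// !mulNr opprK.
Qed.

(** Zorn's lemma: a chain of sublinear functionals below p is bounded below at
    x by - p (- x), and its pointwise infimum is again sublinear because any
    two members of the chain are comparable. *)
Lemma minimal_sublinear_exists p : sublinear p ->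
  exists q, [/\ sublinear q, forall x, q x <= p x &
    forall r, sublinear r -> (forall x, r x <= q x) -> r = q].
Proof.
move=> sp.
pose T := {q : V -> R | sublinear q /\ forall x, q x <= p x}.
pose ge (q r : T) := `[< forall x, sval r x <= sval q x >].
have [|||C totC|[q [sq qp]] minq] := @Zorn T ge.
- by move=> q; apply/asboolP.
- move=> q r s /asboolP qr /asboolP rs; apply/asboolP => x.
  exact: le_trans (rs x) (qr x).
- move=> [q ?] [r ?] /asboolP qr /asboolP rq; apply/eq_exist/funext => x.
  by apply/eqP; rewrite eq_le qr rq.
- have [[q0 Cq0]|C0] := pselect (C !=set0); last first.
    exists (exist _ p (conj sp (fun x => lexx (p x)))) => q Cq.
    by case: C0; exists q.
  pose m x := inf [set sval q x | q in C].
  have m_le (q : T) x : C q -> m x <= sval q x.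
    move=> Cq; apply: ge_inf; last by exists q.
    exists (- p (- x)) => _ [r Cr <-].
    case: r {Cr} => r [sr rp] /=.
    by rewrite (le_trans _ (sublinear_geN _ sr))// lerN2.
  have m_ge a x : (forall q : T, C q -> a <= sval q x) -> a <= m x.
    move=> aC; apply: lb_le_inf; first by exists (sval q0 x), q0.
    by move=> _ [q Cq <-]; exact: aC.
  have sm : sublinear m.
    split=> [x y|].
      (* The lower of q and r serves for both x and y. *)
      rewrite -lerBlDr; apply/m_ge => q Cq.
      rewrite lerBlDl -lerBlDr; apply/m_ge => r Cr; rewrite lerBlDl.
      have [/asboolP qr|/asboolP rq] := totC _ _ Cq Cr.
        rewrite (le_trans (m_le _ _ Cr))// (le_trans ((svalP r).1.1 x y))//.
        by rewrite lerD2r.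
      rewrite (le_trans (m_le _ _ Cq))// (le_trans ((svalP q).1.1 x y))//.
      by rewrite lerD2l.
    apply: sublinear_pZ => [a x a0|].
      rewrite -ler_pdivrMl//; apply/m_ge => q Cq; rewrite ler_pdivrMl//.
      by rewrite (le_trans (m_le _ _ Cq))// (svalP q).1.2 ?(ltW a0).
    apply/eqP; rewrite eq_le.
    rewrite (le_trans (m_le _ _ Cq0)) ?(sublinear0 (svalP q0).1)//.
    by apply/m_ge => q Cq; rewrite (sublinear0 (svalP q).1).
  have mp x : m x <= p x by rewrite (le_trans (m_le _ _ Cq0))// (svalP q0).2.
  by exists (exist _ m (conj sm mp)) => q Cq; apply/asboolP => x; exact: m_le.
exists q; split=> // r sr rq.
have rp x : r x <= p x := le_trans (rq x) (qp x).
have /(_ _)/(congr1 sval) := minq (exist _ r (conj sr rp)).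
by apply; apply/asboolP.
Qed.

(** Minimizing below [slide p x0] rather than p: its term t = 1 at - x0 gives
    f (- x0) <= p 0 - p x0 = - p x0, that is, p x0 <= f x0. *)
Lemma hahn_banach_sublinear p x0 : sublinear p ->
  exists f : V -> R,
    [/\ scalar f, forall x, f x <= p x & f x0 = p x0].
Proof.
move=> sp.
have [f [sf fp minf]] := minimal_sublinear_exists (slide_sublinear x0 sp).
have lf := minimal_sublinear_linear sf minf.
have fle x : f x <= p x by rewrite (le_trans (fp x)) ?slide_le_id.
exists f; split=> //; apply/eqP; rewrite eq_le fle/=.
have /(le_trans (fp (- x0))) := slide_le x0 (- x0) sp (@ler01 R).
rewrite scale1r addNr (sublinear0 sp) mul1r sub0r.
by rewrite -[- x0]addr0 -scaleN1r lf (sublinear0 sf) addr0 mulN1r lerN2.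
Qed.

End sublinear.

(** * Norming functionals over the real and complex numbers *)

Section scalar.
Variables (K : nzRingType) (V : lmodType K) (f : V -> K).
Hypothesis lf : scalar f.

Lemma scalar_map0 : f 0 = 0.
Proof.
by apply: (addrI (f 0)); rewrite -{1}[f 0]mul1r -lf scale1r !addr0.
Qed.

Lemma scalar_mapZ a x : f (a *: x) = a * f x.
Proof. by rewrite -[a *: x]addr0 lf scalar_map0 addr0. Qed.

Lemma scalar_mapD x y : f (x + y) = f x + f y.
Proof. by rewrite -[in LHS](scale1r x) lf mul1r. Qed.

Lemma scalar_mapN x : f (- x) = - f x.
Proof. by rewrite -scaleN1r scalar_mapZ mulN1r. Qed.

End scalar.

(** A copy of the carrier, so that the real scaling does not compete with the
    complex one in structure inference. *)
Definition realification (R : realType) (V : lmodType R[i]) : Type := V.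

Section realification.
Variables (R : realType) (V : lmodType R[i]).

HB.instance Definition _ := GRing.Zmodule.copy (realification V) V.

Let scale (a : R) (x : realification V) : realification V := a%:C%C *: (x : V).

Let scaleA a b v : scale a (scale b v) = scale (a * b) v.
Proof. by rewrite /scale scalerA rmorphM. Qed.

Let scale1 : left_id 1 scale.
Proof. by move=> v; rewrite /scale rmorph1 scale1r. Qed.

Let scaleDr : right_distributive scale +%R.
Proof. by move=> a u v; exact: scalerDr. Qed.

Let scaleDl v : {morph scale^~ v : a b / a + b}.
Proof. by move=> a b; rewrite /scale rmorphD scalerDl. Qed.

HB.instance Definition _ := GRing.Zmodule_isLmodule.Build R (realification V)
  scaleA scale1 scaleDr scaleDl.

Lemma realificationZ (a : R) (x : realification V) :
  a *: x = a%:C%C *: (x : V) :> V.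
Proof. by []. Qed.

End realification.

Lemma norming_functional_real (R : realType) (L : normedModType R) (x0 : L) :
  exists f : L -> R,
    [/\ scalar f, forall x, `|f x| <= `|x| & `|f x0| = `|x0|].
Proof.
have norm_sublinear : sublinear (fun x : L => `|x|).
  by split=> [|a x a0]; [exact: ler_normD|rewrite normrZ ger0_norm].
have [f [lf fle fx0]] := hahn_banach_sublinear x0 norm_sublinear.
exists f; split=> [//|x|]; last by rewrite fx0 normr_id.
by rewrite ler_norml lerNl -(scalar_mapN lf) -{1}[`|x|]normrN !fle.
Qed.

(** Real linearity reduces complex linearity to multiplication by i, which
    exchanges the two parts of the complexified functional up to sign. *)
Lemma complexify_scalar (R : realType) (V : lmodType R[i])
    (f : realification V -> R) :
  scalar f -> scalar (fun x : V => (f x)%:C%C - 'i%C * (f ('i%C *: x))%:C%C).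
Proof.
move=> lf.
have fD (x y : V) : f (x + y) = f x + f y := scalar_mapD lf x y.
have fZ a (x : V) : f (a%:C%C *: x) = a * f x := scalar_mapZ lf a x.
case=> a b x y.
have f_cplx (z : V) : f ((a +i* b)%C *: z) = a * f z + b * f ('i%C *: z).
  have -> : (a +i* b)%C = a%:C%C + b%:C%C * 'i%C.
    by apply/eqP; rewrite eq_complex /=; apply/andP; split; apply/eqP; ring.
  by rewrite scalerDl -scalerA fD !fZ.
rewrite fD f_cplx scalerDr fD.
have -> : f ('i%C *: ((a +i* b)%C *: x)) = a * f ('i%C *: x) - b * f x.
  rewrite scalerA mulrC -scalerA f_cplx scalerA -expr2 sqr_i; congr (_ + _).
  by rewrite -(rmorphN1 (real_complex R)) fZ mulN1r mulrN.
apply/eqP; rewrite eq_complex /=; apply/andP; split; apply/eqP; ring.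
Qed.

Lemma norming_functional_complex (R : realType) (L : normedModType R[i])
  (x0 : L) : exists f : L -> R[i],
    [/\ scalar f, forall x, `|f x| <= `|x| & `|f x0| = `|x0|].
Proof.
pose N (x : L) : R := complex.Re `|x|.
have NE x : (N x)%:C%C = `|x| by rewrite RRe_real// normr_real.
have N_sublinear : sublinear (N : realification L -> R).
  split=> [x y|a x a0]; first by rewrite -lecR rmorphD/= !NE ler_normD.
  apply: complexI; rewrite rmorphM/= !NE realificationZ normrZ.
  by rewrite ger0_norm// ler0c.
have [f [lf fle fx0]] :=
  hahn_banach_sublinear (x0 : realification L) N_sublinear.
pose g (x : L) := (f x)%:C%C - 'i%C * (f ('i%C *: x))%:C%C.
have lg : scalar g := complexify_scalar lf.
have Re_g x : complex.Re (g x) = f x by rewrite /g/=; ring.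
have gle x : `|g x| <= `|x|.
  have [->|gx0] := eqVneq (g x) 0; first by rewrite normr0.
  (* u rotates g x onto the nonnegative real axis, where g agrees with f. *)
  pose u := `|g x| / g x.
  have u1 : `|u| = 1 by rewrite normrM normr_id normfV divff// normr_eq0.
  have gux : g (u *: x) = `|g x| by rewrite (scalar_mapZ lg) divfK.
  have <- : `|u *: x| = `|x| by rewrite normrZ u1 mul1r.
  rewrite -gux -NE -[g _]RRe_real ?Re_g ?lecR ?fle//.
  by rewrite gux normr_real.
exists g; split=> //; apply/eqP; rewrite eq_le gle/=.
by rewrite -NE -fx0 -Re_g (le_trans _ (normc_ge_Re _))// lecR ler_norm.
Qed.

Lemma dist_bounded_continuous (K : numFieldType) (V W : normedModType K)
    (h : V -> W) (M : K) : 0 <= M ->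
  (forall u v, `|h u - h v| <= M * `|u - v|) -> continuous h.
Proof.
move=> M0 hM u; apply/cvgrPdist_lt => e e0; near=> v.
apply: (@le_lt_trans _ _ (`|u - v| * (M + 1))).
  by rewrite (le_trans (hM u v))// mulrC ler_wpM2l// lerDl.
rewrite -ltr_pdivlMr ?ltr_wpDl//; near: v.
apply: cvgr_dist_lt; first exact: cvg_id.
by rewrite divr_gt0 ?ltr_wpDl.
Unshelve. all: by end_near. Qed.

(** * The dual space *)

Section norming.
Variables (R : realType) (k : scalar_kind).
Local Notation F := (scalar_field R k).
Variable L : normedModType F.
Implicit Types f : dual L.

Lemma norming_functional (x0 : L) :
  exists f, (forall x, `|f x| <= `|x|) /\ `|f x0| = `|x0|.
Proof.
have [f [lf fle fx0]] : exists f : L -> F,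
    [/\ scalar f, forall x, `|f x| <= `|x| & `|f x0| = `|x0|].
  case: k L x0 => V x; first exact: norming_functional_real.
  exact: norming_functional_complex.
suff fD : f \in @dual_pred F L by exists (Dual fD).
rewrite inE; split=> //; apply: (@dist_bounded_continuous _ _ _ _ 1) => // u v.
by rewrite mul1r -(scalar_mapN lf) -(scalar_mapD lf).
Qed.

Lemma dual_fun_le f (x : L) : `|f x| <= `|f| * `|x|.
Proof.
have fZ := scalar_mapZ (@dual_linear _ _ f : scalar f).
have [->|x0] := eqVneq x 0.
  by rewrite (scalar_map0 (@dual_linear _ _ f : scalar f)) !normr0 mulr0.
have nx0 : 0 < `|x| by rewrite normr_gt0.
have [M fM] := dual_bounded f.
rewrite -ler_pdivrMr// mulrC -[X in X * _]gtr0_norm ?invr_gt0// -normrM -fZ.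
apply: (supnorm_ub fM).
by rewrite /= normrZ normfV normr_id mulVf// lt0r_neq0.
Qed.

Lemma dual_norm_le f M : 0 <= M -> (forall x, `|f x| <= M * `|x|) -> `|f| <= M.
Proof.
move=> M0 fM; apply: supnorm_le => // x /= x1.
by rewrite (le_trans (fM x))// -[leRHS]mulr1 ler_wpM2l.
Qed.

Lemma dual_eval_continuous (x : L) : continuous (fun f => f x).
Proof.
apply: (@dist_bounded_continuous F (dual L) F _ `|x|) => // f g.
by rewrite mulrC; exact: dual_fun_le (f - g) x.
Qed.

End norming.

(** * Existence of Stone-Cech compactifications *)

(** In the complex case the compact set is the image of a square, over which
    compactness comes from that of a product of two segments. *)
Lemma scalar_bounded_compact (R : realType) (k : scalar_kind)
    (M : scalar_field R k) :
  exists2 A : set (scalar_field R k), compact A & forall z, `|z| <= M -> A z.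
Proof.
case: k M => /= M.
  exists `[- M, M]%classic; first exact: segment_compact.
  by move=> z; rewrite ler_norml.
pose r := complex.Re M.
pose c (ab : R * R) : R[i] := (ab.1 +i* ab.2)%C.
exists (c @` (`[- r, r] `*` `[- r, r])).
  apply: continuous_compact; last by apply: compact_setX; exact: segment_compact.
  apply: continuous_subspaceT => -[a b]; apply/cvgrPdist_lt => e e0.
  have er : e = (complex.Re e)%:C%C by rewrite RRe_real// gtr0_real.
  have e0' : 0 < complex.Re e / 2 by rewrite divr_gt0// -ltcR -er.
  near=> z.
  have -> : c (a, b) - c z = (a - z.1)%:C%C + 'i%C * (b - z.2)%:C%C.
    apply/eqP; rewrite eq_complex /=.
    by rewrite !(mul0r, mul1r, mulr0, addr0, add0r, subr0, oppr0) !eqxx.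
  rewrite (le_lt_trans (ler_normD _ _))// normrM.
  have -> : `|'i%C : R[i]| = 1.
    by rewrite normc_def/= expr0n/= add0r expr1n sqrtr1.
  rewrite mul1r !normc_def/= expr0n/= !addr0 !sqrtr_sqr -rmorphD er ltcR.
  rewrite [ltRHS]splitr ltrD//; near: z.
    by apply: (@cvgr_dist_lt _ _ _ (nbhs (a, b)) _ fst); [exact: cvg_fst|].
  by apply: (@cvgr_dist_lt _ _ _ (nbhs (a, b)) _ snd); [exact: cvg_snd|].
move=> z zM; exists (complex.Re z, complex.Im z); last by case: z zM.
have Mr : M = r%:C%C.
  by rewrite RRe_real// ger0_real// (le_trans _ zM).
have zr (t : R) : `|t| ^+ 2 <= complex.Re z ^+ 2 + complex.Im z ^+ 2 ->
    `|t| <= r.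
  move=> h; rewrite -lecR -Mr (le_trans _ zM)// normc_def lecR.
  by rewrite -[`|t|]ger0_norm// -sqrtr_sqr ler_sqrt// (le_trans (sqr_ge0 _) h).
split=> /=; rewrite in_itv/= -ler_norml; apply: zr;
  by rewrite real_normK ?num_real// ?lerDl ?lerDr sqr_ge0.
Unshelve. all: by end_near. Qed.

Section set_type_topology.
Context {T : topologicalType} (A : set T).

Lemma set_val_continuous : continuous (set_val : A -> T).
Proof. exact: initial_continuous. Qed.

(** A filter on the subtype is pushed to T; the cluster point found in A is one
    for the original filter since the opens of A are traces of opens of T. *)
Lemma set_type_compact : compact A -> compact [set: A].
Proof.
move=> cA G PG _.
have GA : (set_val @ G) A.
  by apply: (@filterS _ G _ setT); [move=> x _; exact: set_valP|exact: filterT].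
have [p [Ap clp]] := cA _ _ GA.
exists (SigSub (mem_set Ap)); split=> // U B GU [_ [[W oW <-] Wp WB]].
have GU' : (set_val @ G) (set_val @` U).
  by apply: (@filterS _ G _ U) => // u Uu; exists u.
have [_ [[u Uu <-] Wu]] := clp _ _ GU' (open_nbhs_nbhs (conj oW Wp)).
by exists u; split=> //; exact: WB.
Qed.

Lemma set_type_hausdorff : hausdorff_space T -> hausdorff_space A.
Proof.
move=> hT x y clxy.
suff: set_val x = set_val y by rewrite set_valE; exact: val_inj.
apply: hT => U V nU nV.
pose v : A -> T := set_val.
have [z [Uz Vz]] : (v @^-1` U) `&` (v @^-1` V) !=set0.
  by apply: clxy; [exact: set_val_continuous nU|exact: set_val_continuous nV].
by exists (set_val z).
Qed.

End set_type_topology.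

(** Classical choice equips this type with the equality needed of the index
    type of a product of spaces. *)
Definition bounded_continuous (K : numFieldType) (X : topologicalType) :=
  {classic {f : X -> K | continuous f /\ bounded_fun f}}.

Definition bounded_continuous_eval (K : numFieldType) (X : topologicalType)
  (f : bounded_continuous K X) : X -> K := sval f.

Section stone_cech_existence.
Variables (R : realType) (k : scalar_kind) (X : topologicalType).
Local Notation F := (scalar_field R k).
Local Notation BC := (bounded_continuous F X).
Local Notation ev := (@bounded_continuous_eval F X).
Local Notation cube := (prod_topology (fun _ : BC => F)).
Local Notation e := (@join_product BC X (fun _ => F) ev).

(** Each coordinate of the image is a bounded function, hence lands in a compact
    set A i; the product of the A i is compact by Tychonoff and closed. *)
Lemma cube_range_compact : compact (closure (range e)).
Proof.
have /choice[A cA] :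
    forall i : BC, exists A : set F, compact A /\ forall x, A (ev i x).
  move=> i.
  have [M M0 iM] : exists2 M : F, 0 < M &
      globally [set: X] [set x | `|ev i x| <= M].
    exact: (pinfty_ex_gt0 (svalP i).2).
  have [A cA MA] := scalar_bounded_compact M.
  by exists A; split=> // x; apply: MA; exact: iM.
pose P : set cube := [set f | forall i, A i (f i)].
have cP : compact P by apply: tychonoff => i; exact: (cA i).1.
have hC : hausdorff_space cube.
  by apply: hausdorff_product => i; exact: norm_hausdorff.
apply: (subclosed_compact _ cP); first exact: closed_closure.
rewrite closureE; apply: smallest_sub; first exact: compact_closed.
by move=> _ [x _ <-] i; exact: (cA i).2.
Qed.

(** For an arbitrary X this compact space receives X continuously; the embedding
    requires the two hypotheses of [stone_cechP]. *)
Definition stone_cech : compactHausdorffType :=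
  @CompactHausdorff (closure (range e)) (set_type_compact cube_range_compact)
    (set_type_hausdorff (hausdorff_product (fun=> @norm_hausdorff F F))).

Definition stone_cech_embed (x : X) : stone_cech :=
  SigSub (mem_set (subset_closure (imageP e (I : [set: X] x)))).

Hypothesis sepX : separate_points_from_closed ev.
Hypothesis accX : accessible_space X.

(** The extension of f to the closure of the image is the projection onto the
    coordinate f. *)
Lemma stone_cechP : is_stone_cech F stone_cech_embed.
Proof.
have evC (i : BC) : continuous (ev i) := (svalP i).1.
have e_inj : set_inj [set: X] e := join_product_inj sepX accX.
have valK x : set_val (stone_cech_embed x) = e x by [].
split; first split.
- by move=> x y /(congr1 set_val) exy; apply: e_inj; rewrite ?inE.
- move=> U; split.
    rewrite (join_product_initial sepX evC e_inj) => -[W oW <-].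
    by exists (set_val @^-1` W) => //; exists W.
  move=> [_ [W oW <-] ->].
  rewrite (join_product_initial sepX evC e_inj).
  by exists W.
- move=> O [p Op] [W oW WO].
  have Wp : W (set_val p) by rewrite -[W _]/((set_val @^-1` W) p) WO.
  have [|_ [[x _ <-] Wx]] := set_valP p W _; first exact: open_nbhs_nbhs.
  by exists (stone_cech_embed x); split; [rewrite -WO|exists x].
- move=> f cf bf; pose i : BC := exist _ f (conj cf bf).
  exists (fun y : stone_cech => proj i (set_val y)) => // y.
  apply: continuous_comp; first exact: set_val_continuous.
  exact: proj_continuous.
Qed.

End stone_cech_existence.

Section subset_separation.
Variables (R : realType) (k : scalar_kind).
Local Notation F := (scalar_field R k).
Variables (V : normedModType F) (A : set V).

(** The value at y only depends on the distance to x, is 1 exactly at x, and is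
    bounded; the reciprocal avoids truncating the distance with a minimum, which
    is awkward for the partial order of the complex numbers. *)
Definition peak (x y : A) : F := (1 + `|set_val x - set_val y|)^-1.

Lemma peak_continuous x : continuous (peak x).
Proof.
move=> y; pose h (v : V) : F := (1 + `|set_val x - v|)^-1.
suff ch : continuous h.
  apply: (@continuous_comp A V F set_val h); last exact: ch.
  exact: set_val_continuous.
move=> v; apply: cvgV; first by rewrite lt0r_neq0// ltr_wpDr.
apply: cvgD; first exact: cvg_cst.
apply: cvg_norm; apply: cvgB; first exact: cvg_cst.
exact: cvg_id.
Qed.

Lemma peak_bounded x : bounded_fun (peak x).
Proof.
exists 1; split=> // M M1 y _ /=.
rewrite (le_trans _ (ltW M1))// ger0_norm ?invr_ge0 ?addr_ge0//.
by rewrite invf_le1 ?ltr_wpDr// lerDl.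
Qed.

(** If the e-ball around x avoids U, then [peak x] is at most 1 / (1 + e) on U,
    away from its value 1 at x. *)
Lemma bounded_continuous_separates :
  separate_points_from_closed (@bounded_continuous_eval F A).
Proof.
move=> U x cU Ux.
pose i : bounded_continuous F A :=
  exist _ (peak x) (conj (@peak_continuous x) (peak_bounded x)).
exists i; rewrite -[bounded_continuous_eval i]/(peak x) => clx.
have [W oW WU] : open (~` U) by exact: closed_openC.
have Wx : W (set_val x) by rewrite -[W _]/((set_val @^-1` W) x) WU.
have [e /= e0 eW] : exists2 e : F, 0 < e &
    forall v, `|set_val x - v| < e -> W v.
  have /nbhs_normP[e /= e0 eW] := open_nbhs_nbhs (conj oW Wx).
  by exists e.
pose d : F := 1 - (1 + e)^-1.
have d0 : 0 < d by rewrite subr_gt0 invf_lt1 ?ltrDl// addr_gt0.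
have [|_ [[y Uy <-] /=]] := clx [set z | `|peak x x - z| < d].
  by apply/nbhs_normP; exists d.
rewrite {1}/peak subrr normr0 addr0 invr1 => xyd.
suff /eW : `|set_val x - set_val y| < e.
  by rewrite -[W _]/((set_val @^-1` W) y) WU.
move: xyd; rewrite ger0_norm; last first.
  by rewrite subr_ge0 invf_le1 ?ltr_wpDr// lerDl.
have xy0 : 0 < 1 + `|set_val x - set_val y| by rewrite ltr_wpDr.
have e1 : 0 < 1 + e by rewrite addr_gt0.
by rewrite /d /peak ltrD2l ltrN2 ltf_pV2 ?posrE// ltrD2l.
Qed.

Lemma subset_stone_cech_exists :
  exists (bX : compactHausdorffType) (i : A -> bX), is_stone_cech F i.
Proof.
have accA : accessible_space A.
  exact/hausdorff_accessible/set_type_hausdorff/norm_hausdorff.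
exists (stone_cech R k A), (@stone_cech_embed R k A).
exact: stone_cechP bounded_continuous_separates accA.
Qed.

End subset_separation.

(** * The isometric embedding *)

(** The set where |h| > c is open, so it would meet D if it were nonempty. *)
Lemma dense_norm_le (K : numFieldType) (Y : topologicalType) (D : set Y)
    (h : Y -> K) (c : K) : dense D -> continuous h -> 0 <= c ->
  (forall y, D y -> `|h y| <= c) -> forall y, `|h y| <= c.
Proof.
move=> dD ch c0 hc y; rewrite real_leNgt ?ger0_real//; apply/negP => cy.
have oh : open [set z | c < `|h z|].
  rewrite openE => z /= cz; have e0 : 0 < `|h z| - c by rewrite subr_gt0.
  have /cvgrPdist_lt/(_ _ e0) := ch z; apply: filterS => t zt.
  by have := le_lt_trans (lerB_dist _ _) zt; rewrite ltrD2l ltrN2.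
have [|z [/= cz Dz]] := dD _ _ oh; first by exists y.
by have := lt_le_trans cz (hc z Dz); rewrite ltxx.
Qed.

Lemma dense_continuous_eq (K : numFieldType) (Y : topologicalType) (D : set Y)
    (g h : Y -> K) : dense D -> continuous g -> continuous h ->
  (forall y, D y -> g y = h y) -> g =1 h.
Proof.
move=> dD cg ch gh y; apply/eqP; rewrite -subr_eq0 -normr_le0.
apply: (@dense_norm_le _ _ D (fun z => g z - h z)) => // [z|z Dz].
  by apply: cvgB; [exact: cg|exact: ch].
by rewrite gh// subrr normr0.
Qed.

Section embedding.
Variables (R : realType) (k : scalar_kind).
Local Notation F := (scalar_field R k).
Variable L : normedModType F.

(** Dividing by the norm of f makes the evaluation bounded on the whole
    punctured dual, and the removal of 0 makes the quotient continuous. *)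
Definition normalized_eval (x : L) (f : punctured_dual L) : F :=
  (set_val f : dual L) x / `|set_val f|.

Lemma punctured_dual_gt0 (f : punctured_dual L) : 0 < `|set_val f|.
Proof. by rewrite normr_gt0; exact: (set_valP f). Qed.

Lemma normalized_eval_continuous x : continuous (normalized_eval x).
Proof.
move=> f; pose g (h : dual L) : F := h x / `|h|.
apply: (@continuous_comp _ (dual L) F set_val g).
  exact: set_val_continuous.
have gf : g h @[h --> nbhs (set_val f)] --> g (set_val f).
  apply: cvgM; first exact: dual_eval_continuous.
  by apply: cvgV; [rewrite lt0r_neq0// punctured_dual_gt0|exact: cvg_norm].
exact: gf.
Qed.

Lemma normalized_eval_le x f : `|normalized_eval x f| <= `|x|.
Proof.
rewrite normrM normfV normr_id ler_pdivrMr ?punctured_dual_gt0// mulrC.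
exact: dual_fun_le.
Qed.

Lemma normalized_eval_bounded x : bounded_fun (normalized_eval x).
Proof.
exists `|x|; split=> // M xM f _ /=.
exact: le_trans (normalized_eval_le _ _) (ltW xM).
Qed.

(** A norming functional of x has norm at most 1, so that normalizing it can
    only increase the modulus of its value at x. *)
Lemma normalized_eval_norming x : x != 0 ->
  exists f, `|x| <= `|normalized_eval x f|.
Proof.
move=> x0; have [f [fle fx]] := norming_functional x.
have f0 : [set g : dual L | g != 0] f.
  by apply: contra_neq x0 => /= f0; apply/normr0_eq0; rewrite -fx f0 normr0.
exists (SigSub (mem_set f0) : punctured_dual L).
rewrite /normalized_eval/= normrM normfV normr_id fx.
rewrite ler_pdivlMr ?normr_gt0// -[leRHS]mulr1 ler_wpM2l//.
by apply: dual_norm_le => // y; rewrite mul1r.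
Qed.

Lemma normalized_eval_linear (a : F) x y f :
  normalized_eval (a *: x + y) f =
  a * normalized_eval x f + normalized_eval y f.
Proof. by rewrite /normalized_eval dual_linear mulrDl mulrA. Qed.

(** The additive and homogeneous laws hold on the dense image of the punctured
    dual by [normalized_eval_linear], hence everywhere; so does the upper bound
    on the norm, while the lower bound is attained at a norming functional. *)
Lemma stone_cech_embedding (bX : compactHausdorffType)
    (i : punctured_dual L -> bX) : is_stone_cech F i ->
  exists Theta : {linear L -> cfun F bX}, forall x, `|Theta x| = `|x|.
Proof.
move=> [[_ _ dense_i] ext].
have /choice[T TP] : forall x : L, exists g : cfun F bX,
    forall f, g (i f) = normalized_eval x f.
  move=> x; have [g cg gE] := ext _ (@normalized_eval_continuous x)
    (normalized_eval_bounded x).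
  have gP : g \in @cfun_pred F bX by rewrite inE.
  by exists (Cfun gP).
have T_linear : linear T.
  move=> a x y; apply/val_inj/funext.
  apply: (dense_continuous_eq dense_i); try exact: cfun_continuous.
  move=> _ [f _ <-].
  rewrite -[LHS]/(T (a *: x + y) (i f)) -[RHS]/(a * T x (i f) + T y (i f)).
  by rewrite !TP normalized_eval_linear.
pose lT := @GRing.isLinear.Build F L (cfun F bX) *:%R T T_linear.
pose Theta : {linear L -> cfun F bX} := HB.pack T lT.
exists Theta => x /=.
have Tle y : `|T x y| <= `|x|.
  apply: (dense_norm_le dense_i) => //; first exact: cfun_continuous.
  by move=> _ [f _ <-]; rewrite TP normalized_eval_le.
apply/eqP; rewrite eq_le; apply/andP; split.
  by apply: supnorm_le => // y _; exact: Tle.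
have [->|x0] := eqVneq x 0; first by rewrite normr0.
have [f xf] := normalized_eval_norming x0.
rewrite (le_trans xf)// -TP.
exact: (@supnorm_ub R k _ setT (T x) `|x| (fun y _ => Tle y)).
Qed.

End embedding.

Theorem theorem2p1 (R : realType) (k : scalar_kind)
    (L : normedModType (scalar_field R k)) :
  (exists (bX : compactHausdorffType) (i : punctured_dual L -> bX),
     is_stone_cech (scalar_field R k) i) /\
  (forall (bX : compactHausdorffType) (i : punctured_dual L -> bX),
     is_stone_cech (scalar_field R k) i ->
     exists Theta : {linear L -> cfun (scalar_field R k) bX},
       forall x : L, `|Theta x| = `|x|).
Proof.
split; first exact: subset_stone_cech_exists.
by move=> bX i; exact: stone_cech_embedding.
Qed.
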